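(* Let $f:[0,1]\to[0,1]$ be a continuous, topologically transitive, piecewise monotone map, let $h(f)$ denote its topological entropy, and fix $x\in[0,1]$. Then $$\limsup_{n\to\infty}\frac{\# f^{-n}(x)}{e^{n h(f)}}>0,$$ where $\# f^{-n}(x)$ is the cardinality of $f^{-n}(x)=\{y\in[0,1] : f^n(y)=x\}$.
   Context: A continuous map $f:[0,1]\to[0,1]$ is piecewise monotone if the set of critical points $\mathrm{Crit}(f)=\{0,1\}\cup\{x : f \text{ is not monotone on any neighborhood of } x\}$ is finite. Topologically transitive means: for all nonempty open $U,V\subseteq[0,1]$ there is $n\ge 1$ with $f^n(U)\cap V\ne\emptyset$. *)

(* Defs.v *)
From mathcomp Require Import all_boot all_order all_algebra.
From mathcomp Require Import all_classical all_reals all_analysis.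
Set Implicit Arguments.
Unset Strict Implicit.
Unset Printing Implicit Defensive.
Import Order.TTheory GRing.Theory Num.Theory.
Import numFieldNormedType.Exports.

Local Open Scope classical_set_scope.
Local Open Scope ring_scope.

(* A self-map of a subset X of T is represented by a total f : T -> T with
   f @` X `<=` X; the definitions below only depend on f restricted to X. *)

(* The relatively open subsets of X are the U `&` X with U open in T. *)
Definition topologically_transitive (T : topologicalType) (X : set T)
    (f : T -> T) : Prop :=
  forall U V : set T, open U -> open V ->
    U `&` X !=set0 -> V `&` X !=set0 ->
    exists2 n : nat, (1 <= n)%N &
      (iter n f @` (U `&` X)) `&` (V `&` X) !=set0.

(* E is an (n, eps)-separated subset of X for the Bowen metric
   d_n(x, y) = max_(k < n) `|f^k x - f^k y|. *)
Definition separated (R : realType) (X : set R) (f : R -> R)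
    (n : nat) (eps : R) (E : set R) : Prop :=
  E `<=` X /\
  forall x y, E x -> E y -> x <> y ->
    exists2 k : nat, (k < n)%N & eps < `|iter k f x - iter k f y|.

(* [counting] is the cardinality of a set, +oo if the set is infinite. *)
Definition separated_card (R : realType) (X : set R) (f : R -> R)
    (n : nat) (eps : R) : \bar R :=
  ereal_sup [set counting E | E in separated X f n eps].

(* Bowen-Dinaburg definition:
   h(f) = lim_(eps -> 0+) limsup_n (1/n) ln s_n(eps),
   with natural logarithms. *)
Definition topological_entropy (R : realType) (X : set R)
    (f : R -> R) : \bar R :=
  lim ((fun eps : R =>
    limn_esup (fun n => (lne (separated_card X f n eps) / n%:R%:E)%E))
      @ 0^'+).

Definition unit_interval (R : realType) : set R := `[0, 1].
Arguments unit_interval R : clear implicits.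

(* Monotone in the weak sense: constant functions are monotone. *)
Definition monotone_on (R : realType) (A : set R) (f : R -> R) : Prop :=
  (forall x y, A x -> A y -> x <= y -> f x <= f y) \/
  (forall x y, A x -> A y -> x <= y -> f y <= f x).

(* Neighborhoods of x are taken in [0, 1]. *)
Definition Crit (R : realType) (f : R -> R) : set R :=
  [set 0; 1] `|`
  [set x | unit_interval R x /\
     ~ exists2 U : set R, nbhs x U & monotone_on (U `&` unit_interval R) f].

Definition piecewise_monotone (R : realType) (f : R -> R) : Prop :=
  finite_set (Crit f).

(* Main.v *)
(** Let [crits n] be the set of points hitting a critical point at some time at
    most n, and d_n its cardinality. Each f^n is monotone between consecutive
    points of [crits n], so (n, eps)-separated sets have at most
    d_n (n / eps + 1) points, and d_(m+n) <= 2 d_m d_n. Hence, with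
    lam = e^h, d_n < lam^n / 2 for a single n >= 1 would already give an entropy
    below h.

    Suppose h > 0 and #f^-n(x) = o(lam^n). The same then holds for all points of
    the backward orbit of x, which is dense. Given a critical point c and K,
    choose such points y1 < c < y2 so close to c that no critical point enters
    ]y1, y2[ \ {c} before time K. The monotone branch of f^n through a preimage
    of c either covers y1 or y2, or has an end of [crits (n - K)]; so
    #f^-n(c) <= 1 + #f^-n(y1) + #f^-n(y2) + d_(n-K). Summing over c gives
    d_(n+1) <= d_n + o(lam^n) + q d_(n+1-K) with q independent of K, which for
    large K forces d_n = o(lam^n), a contradiction. *)
Require Import Defs.
From mathcomp Require Import all_boot all_order all_algebra.
From mathcomp Require Import finmap.
From mathcomp Require Import all_classical all_reals all_analysis.
From mathcomp Require Import ring lra zify.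
Set Implicit Arguments.
Unset Strict Implicit.
Unset Printing Implicit Defensive.
Import Order.TTheory GRing.Theory Num.Theory.
Import numFieldNormedType.Exports.

Local Open Scope classical_set_scope.
Local Open Scope ring_scope.


(** * Cardinalities of finite sets *)

Definition ncard (T : choiceType) (A : set T) : nat := #|` fset_set A|.

(** Since [P t] passes to smaller radii, the minimum of finitely many radii serves all points at
    once. *)
Lemma finite_uniform_radius (R : realType) (T : Type) (A : set T) (P : T -> R -> Prop) :
  finite_set A -> (forall t, A t -> exists2 e, 0 < e & P t e) ->
  (forall t e e', A t -> 0 < e' -> e' <= e -> P t e -> P t e') ->
  exists2 e, 0 < e & forall t, A t -> P t e.
Proof.
elim/Pchoice: T => T in A P *.
move=> /finite_seqP[s ->] {A} HP HD.
elim: s HP HD => [|t s IH] HP HD; first by exists 1.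
have [e e0 He] : exists2 e, 0 < e & forall t, [set` s] t -> P t e.
  apply: IH => [u us|u e e' us]; first by apply: HP; rewrite /= inE us orbT.
  by apply: HD; rewrite /= inE us orbT.
have [|e1 e10 He1] := HP t; first by rewrite /= inE eqxx.
exists (Num.min e e1); first by rewrite lt_min e0.
move=> u /=; rewrite inE => /orP[/eqP ->|us].
  apply: HD He1; rewrite ?ge_min ?lexx ?orbT ?lt_min ?e0//.
  by rewrite /= inE eqxx.
apply: HD (He _ us); rewrite ?ge_min ?lexx ?orbT ?lt_min ?e0//.
by rewrite /= inE us orbT.
Qed.

Lemma finite_isolated (R : realType) (A : set R) (a : R) : finite_set A ->
  exists2 e, 0 < e & forall c, A c -> c != a -> e < `|c - a|.
Proof.
move=> fA; apply: finite_uniform_radius => // [c Ac|c e e' _ _ e'e H /H]; last first.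
  exact: le_lt_trans.
have [->|ca] := eqVneq c a; first by exists 1.
exists (`|c - a| / 2) => [|_]; first by rewrite divr_gt0// normr_gt0 subr_eq0.
by rewrite ltr_pdivrMr// ltr_pMr ?ltr1n// normr_gt0 subr_eq0.
Qed.

Lemma finite_avoid (R : realType) (A : set R) (a b : R) : finite_set A ->
  a < b -> exists2 z, a < z < b & ~ A z.
Proof.
move=> fA ab; have [e e0 He] := finite_isolated a fA.
pose d := Num.min e ((b - a) / 2).
have d0 : 0 < d by rewrite lt_min e0 divr_gt0// subr_gt0.
have db : d <= (b - a) / 2 by rewrite ge_min lexx orbT.
exists (a + d); first by rewrite ltrDl d0/=; lra.
move=> /He; rewrite [a + d]addrC addrK gtr0_norm// => /(_ _).
rewrite -subr_eq0 addrK gt_eqF// => /(_ isT).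
by rewrite ltNge ge_min lexx.
Qed.

(* [r] is a relation rather than a function so that callers need not choose. *)
Lemma ncard_le_rel (T : choiceType) (U : pointedType) (A : set T) (B : set U)
    (r : T -> U -> Prop) : finite_set B ->
  (forall t, A t -> exists2 u, B u & r t u) ->
  (forall t t' u, A t -> A t' -> B u -> r t u -> r t' u -> t = t') ->
  finite_set A /\ (ncard A <= ncard B)%N.
Proof.
move=> fB Hr Hi.
have /choice[g Hg] : forall t, exists u, A t -> B u /\ r t u.
  move=> t; have [At|nA] := pselect (A t); last by exists point.
  by have [u Bu rtu] := Hr _ At; exists u.
have ginj : {in A &, injective g}.
  move=> t t'; rewrite !inE => At At' gg.
  have [Bu ru] := Hg _ At; have [_ ru'] := Hg _ At'.
  by apply: Hi At At' Bu ru _; rewrite gg.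
have gB : g @` A `<=` B by move=> _ [t At <-]; have [] := Hg _ At.
have gA := inj_card_eq ginj.
have fgA := sub_finite_set gB fB.
have fA : finite_set A by rewrite -(eq_finite_set gA).
split=> //; rewrite /ncard.
have /(fcard_eq fgA fA) <- := gA.
by apply: fsubset_leq_card; rewrite -fset_set_sub.
Qed.

(** Finiteness of [B] matters: [fset_set] of an infinite set is empty, so [ncard] is then 0. *)
Lemma ncard_sub (T : choiceType) (A B : set T) :
  finite_set B -> A `<=` B -> (ncard A <= ncard B)%N.
Proof.
move=> fB AB; apply: fsubset_leq_card; rewrite -fset_set_sub//.
exact: sub_finite_set fB.
Qed.

Lemma ncard_setU (T : choiceType) (A B : set T) :
  finite_set A -> finite_set B -> (ncard (A `|` B) <= ncard A + ncard B)%N.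
Proof. by move=> fA fB; rewrite /ncard fset_setU// leq_card_fsetU. Qed.

Lemma ncard_bigcup (T U : choiceType) (C : set T) (A : T -> set U) (M : nat) :
  finite_set C ->
  (forall c, C c -> finite_set (A c)) -> (forall c, C c -> ncard (A c) <= M)%N ->
  (ncard (\bigcup_(c in C) A c) <= ncard C * M)%N.
Proof.
move=> fC fA AM; rewrite -(bigsetU_fset_set A fC) /ncard.
have : forall c, c \in enum_fset (fset_set C) -> finite_set (A c) /\ (ncard (A c) <= M)%N.
  move=> c cC; have : c \in fset_set C by [].
  by rewrite in_fset_set// inE => Cc; split; [exact: fA|exact: AM].
elim: (enum_fset (fset_set C)) => [|c s IH] H.
  by rewrite big_nil fset_set0 cardfs0.
rewrite big_cons mulSn; have [fAc AcM] := H c (mem_head _ _).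
have Hs d : d \in s -> finite_set (A d) /\ (ncard (A d) <= M)%N.
  by move=> ds; apply: H; rewrite inE ds orbT.
apply: (leq_trans (ncard_setU fAc _)); last first.
  by rewrite leq_add//; exact: IH.
rewrite big_seq; elim/big_ind: _ => // [X Y fX fY|d ds].
  by rewrite finite_setU.
exact: (Hs _ ds).1.
Qed.

Lemma ncard_setX (T : choiceType) (U : pointedType) (A : set T) (B : set U) :
  finite_set A -> finite_set B -> (ncard (A `*` B) <= ncard A * ncard B)%N.
Proof.
move=> fA fB.
have H (a : T) : finite_set ([set a] `*` B) /\ (ncard ([set a] `*` B) <= ncard B)%N.
  apply: (@ncard_le_rel _ _ _ B (fun p u => p.2 = u)) => //.
    by move=> [a' u] [/= _ Bu]; exists u.
  by move=> [a1 u1] [a2 u2] u [/= -> _] [/= -> _] _ -> ->.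
have -> : A `*` B = \bigcup_(a in A) ([set a] `*` B).
  apply/seteqP; split=> [[a u] [/= Aa Bu]|[a u] [a' Aa' [/= -> Bu]]] //.
  by exists a.
by apply: ncard_bigcup => // a _; have [] := H a.
Qed.

Lemma ncard_gt0 (T : choiceType) (A : set T) : finite_set A -> A !=set0 ->
  (0 < ncard A)%N.
Proof.
move=> fA [t At]; rewrite /ncard cardfs_gt0; apply/fset0Pn; exists t.
by rewrite in_fset_set// inE.
Qed.

(** The point found is the right end of the gap of [A] at [z]. The counting arguments record this
    end for each point, so that points with the same record lie on one branch of an iterate. *)
Lemma finite_next (R : realType) (A : set R) (z b : R) :
  finite_set A -> A b -> z <= b ->
  exists2 c, A c & z <= c /\ forall t, z <= t < c -> ~ A t.
Proof.
move=> /finite_seqP[s ->] {A}; elim: s b => // a s IH b.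
rewrite /= inE => bas zb.
have [c cas [zc Hc]] : exists2 c, c \in a :: s & z <= c /\ forall t, z <= t < c -> t \notin s.
  have [[b' b's zb']|Hn] := pselect (exists2 b', b' \in s & z <= b').
    have [c cs [zc H]] := IH _ b's zb'.
    by exists c; [rewrite inE cs orbT|split => // t /H /negP].
  exists b; first by rewrite inE.
  split=> // t /andP[zt _]; apply/negP => ts; apply: Hn; by exists t.
have [za|az] := leP z a.
  exists (Num.min a c); first by case: leP => _ //; rewrite inE eqxx.
  split; first by rewrite le_min za.
  move=> t /andP[zt]; rewrite lt_min => /andP[ta tc].
  by rewrite inE => /orP[/eqP ta'|/(negP (Hc _ _))]; [rewrite ta' ltxx in ta|rewrite zt tc; auto].
exists c => //; split => // t /andP[zt tc]; rewrite inE => /orP[/eqP ta|].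
  by rewrite -ta ltNge zt in az.
by apply/negP/Hc; rewrite zt.
Qed.


(** * Continuous functions injective on an interval *)

Lemma IVT_continuous (R : realType) (g : R -> R) (a b v : R) :
  continuous g -> a <= b -> (g a <= v <= g b) \/ (g b <= v <= g a) ->
  exists2 c, a <= c <= b & g c = v.
Proof.
move=> gc ab H; have [||c] := @IVT R g a b v ab; last by rewrite in_itv; exists c.
  exact: continuous_subspaceT.
by case: H => /andP[H1 H2]; [rewrite ge_min H1 le_max H2 orbT|
  rewrite ge_min H1 le_max H2 !orbT].
Qed.

Lemma inj_between (R : realType) (g : R -> R) (a b t : R) :
  continuous g -> a <= t <= b -> {in `[a, b] &, injective g} ->
  (g a <= g t <= g b) \/ (g b <= g t <= g a).
Proof.
move=> gc /andP[at_ tb] gi.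
have ab := le_trans at_ tb.
have /unstable.strict_monotonicW [H|H] :=
  itv_continuous_inj_mono (continuous_subspaceT gc) gi; [left|right];
  by rewrite !H// in_itv/= ?lexx ?at_ ?ab ?tb.
Qed.

Lemma itv_inj (R : realType) (g : R -> R) (a b : R) :
  (forall u v, a <= u -> u < v -> v <= b -> g u <> g v) ->
  {in `[a, b] &, injective g}.
Proof.
move=> H u v; rewrite !in_itv/= => /andP[au ub] /andP[av vb] uv.
have [uv'|vu'|//] := ltgtP u v.
  by have := H _ _ au uv' vb uv.
by have := H _ _ av vu' ub (esym uv).
Qed.

(** * Monotone branches of the iterates *)

Section dynamics.
Context (R : realType) (f : R -> R).
Context (fc : continuous f).
Context (fI : forall t, unit_interval R t -> unit_interval R (f t)).
Context (ft : topologically_transitive (unit_interval R) f).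

Local Notation I := (unit_interval R).

Lemma unit_intervalE (t : R) : I t = (0 <= t <= 1).
Proof. by rewrite /unit_interval /= in_itv. Qed.

Lemma iter_unit n t : I t -> I (iter n f t).
Proof. by move=> It; elim: n => //= n; exact: fI. Qed.

Lemma iter_continuous n : continuous (iter n f).
Proof.
elim: n => [|n IH] t; first exact: cvg_id.
by apply: (@continuous_comp _ _ _ (iter n f) f); [exact: IH|exact: fc].
Qed.

Lemma unit_itv_meet (a b : R) : 0 <= a -> a < b -> b <= 1 ->
  `]a, b[%classic `&` I !=set0.
Proof.
move=> a0 ab b1; by exists ((a + b) / 2); split; [rewrite /= in_itv/=|rewrite unit_intervalE]; lra.
Qed.

(** Otherwise the complement of [A] would be an open set meeting [I] that is never reached from []a,
    b[], whose forward orbit stays in [A]. *)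
Lemma transitive_invariant (A : set R) (a b : R) :
  closed A -> (forall t, I t -> A t -> A (f t)) -> 0 <= a -> a < b -> b <= 1 ->
  (forall t, a < t < b -> A t) -> I `<=` A.
Proof.
move=> Ac Af a0 ab b1 abA z Iz; apply: contrapT => nAz.
have [||||n _ [w [[u [/=]]]]] := @ft `]a, b[%classic (~` A).
- exact: itv_open.
- exact: closed_openC.
- exact: unit_itv_meet.
- by exists z.
rewrite in_itv/= => uab Iu <-{w} [nA _]; apply: nA.
elim: n => [|n IH] /=; first exact: abA.
by apply: Af => //; exact: iter_unit.
Qed.

(** All iterates of positive order take their values in the compact set [f(I)], so its open
    complement cannot meet [I]. *)
Lemma transitive_surj z : I z -> exists2 t, I t & f t = z.
Proof.
move=> Iz; apply: contrapT => nz.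
have Ic : compact I by exact: segment_compact.
have fIc : closed (f @` I).
  apply: compact_closed; first exact: Rhausdorff.
  by apply: continuous_compact => //; exact: continuous_subspaceT.
have [||||n n1 [w [[u [/= _ Iu]]]]] := @ft setT (~` (f @` I)).
- exact: openT.
- exact: closed_openC.
- by exists 0; split => //; rewrite unit_intervalE lexx ler01.
- by exists z; split => // -[t It ftz]; apply: nz; exists t.
move=> <-{w} [nA _]; apply: nA; case: n n1 => // n _ /=.
by exists (iter n f u) => //; exact: iter_unit.
Qed.

Lemma iter_surj n z : I z -> exists2 t, I t & iter n f t = z.
Proof.
elim: n z => [|n IH] z Iz; first by exists z.
have [t It <-] := transitive_surj Iz.
by have [u Iu <-] := IH _ It; exists u.
Qed.

(** If [f] were constant on the interval, a return of the interval to itself would make its value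
    [y] periodic. All later images of the interval would lie in the finite orbit of [y], whose
    complement is open and meets [I]. *)
Lemma transitive_nonconstant (a b : R) : 0 <= a -> a < b -> b <= 1 ->
  exists2 t, a < t < b & f t != f ((a + b) / 2).
Proof.
move=> a0 ab b1; set y := f _; apply: contrapT => H.
have fy t : a < t < b -> f t = y.
  by move=> tab; apply: contrapT => /eqP ne; apply: H; exists t.
have [||||n n1 [w [[u [/=]]]]] := @ft `]a, b[%classic `]a, b[%classic.
- exact: itv_open.
- exact: itv_open.
- exact: unit_itv_meet.
- exact: unit_itv_meet.
rewrite in_itv/= => uab Iu <-{w} [/=]; rewrite in_itv/= => vab _.
case: n n1 vab => // n _; rewrite iterSr fy// => vab.
pose O := (fun i => iter i f y) @` `I_n.+1.
have fO : finite_set O by apply: finite_image; exact: finite_II.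
have Of t : O t -> O (f t).
  move=> [i /= ilt <-]; case: (ltnP i n) => [lt|ge]; first by exists i.+1.
  have -> : i = n by lia.
  by exists 0%N => //=; rewrite fy.
have [z z01 nOz] : exists2 z : R, 0 < z < 1 & ~ O z by exact: finite_avoid.
have [||||m m1 [w [[t [/=]]]]] := @ft `]a, b[%classic (~` O).
- exact: itv_open.
- apply: closed_openC; apply: compact_closed; first exact: Rhausdorff.
  exact: finite_compact.
- exact: unit_itv_meet.
- by exists z; split => //; rewrite unit_intervalE; move: z01 => /andP[/ltW-> /ltW->].
rewrite in_itv/= => tab It <-{w} [nA _]; apply: nA.
case: m m1 => // m _; rewrite iterSr fy//.
by elim: m => [|m IH] /=; [exists 0%N|exact: Of].
Qed.

(* [Crit] uses weak monotonicity, so an increasing, a constant and a decreasing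
   piece can be glued without creating a critical point; transitivity excludes
   the constant piece. *)
Lemma Crit_free_inj (a b : R) : 0 <= a -> b <= 1 ->
  (forall t, a < t < b -> ~ Crit f t) -> {in `[a, b] &, injective f}.
Proof.
move=> a0 b1 nC; apply: itv_inj => u v au uv vb fuv.
(* No interior value is extremal on [[u, v]]: [f] is monotone near [z], so an extremum there would
   make it constant on one side of [z]. *)
have noext z : u < z < v ->
    (forall t, u <= t <= v -> f t <= f z) \/ (forall t, u <= t <= v -> f z <= f t) ->
    False.
  move=> /andP[uz zv] ext.
  have Iz : I z by rewrite unit_intervalE; apply/andP; split; lra.
  have azb : a < z < b by apply/andP; split; lra.
  apply: (nC z azb); right; split => // -[U nU mU].
  have [e /= e0 eU] : exists2 e : R, 0 < e & forall t, `|t - z| < e -> U t.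
    have /nbhs_ballP[e /= e0 eU] := nU; exists e => // t te; apply: eU.
    by rewrite /ball/= distrC.
  pose d := Num.min (e / 2) (Num.min ((v - z) / 2) ((z - u) / 2)).
  have d0 : 0 < d by rewrite !lt_min; apply/and3P; split; lra.
  have de : d <= e / 2 by rewrite ge_min lexx.
  have dv : d <= (v - z) / 2 by rewrite !ge_min lexx orbT.
  have du : d <= (z - u) / 2 by rewrite !ge_min lexx !orbT.
  have UI t : z - d <= t <= z + d -> (U `&` I) t.
    move=> /andP[t1 t2]; split; last by rewrite unit_intervalE; apply/andP; split; lra.
    by apply: eU; rewrite ltr_norml; apply/andP; split; lra.
  have UIz : (U `&` I) z by apply: UI; apply/andP; split; lra.
  have right_const : ~ (forall t, z < t < z + d -> f t = f z).
    move=> H; have [|||t tz /eqP] := @transitive_nonconstant z (z + d); try lra.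
    by rewrite H// H//; apply/andP; split; lra.
  have left_const : ~ (forall t, z - d < t < z -> f t = f z).
    move=> H; have [|||t tz /eqP] := @transitive_nonconstant (z - d) z; try lra.
    by rewrite H// H//; apply/andP; split; lra.
  case: mU => mU; case: ext => ext.
  - apply: right_const => t /andP[t1 t2]; apply/eqP; rewrite eq_le.
    apply/andP; split; first by apply: ext; apply/andP; split; lra.
    by apply: mU => //; [apply: UI; apply/andP; split; lra|lra].
  - apply: left_const => t /andP[t1 t2]; apply/eqP; rewrite eq_le.
    apply/andP; split; last by apply: ext; apply/andP; split; lra.
    by apply: mU => //; [apply: UI; apply/andP; split; lra|lra].
  - apply: left_const => t /andP[t1 t2]; apply/eqP; rewrite eq_le.
    apply/andP; split; first by apply: ext; apply/andP; split; lra.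
    by apply: mU => //; [apply: UI; apply/andP; split; lra|lra].
  - apply: right_const => t /andP[t1 t2]; apply/eqP; rewrite eq_le.
    apply/andP; split; last by apply: ext; apply/andP; split; lra.
    by apply: mU => //; [apply: UI; apply/andP; split; lra|lra].
(* By [noext] the extreme values can only be attained at [u] or [v], where [f] agrees; so [f] would
   be constant on [[u, v]]. *)
have [M] := @EVT_max _ f u v (ltW uv) (continuous_subspaceT fc).
have [m] := @EVT_min _ f u v (ltW uv) (continuous_subspaceT fc).
rewrite !in_itv/= => /andP[um mv] mP /andP[uM Mv] MP.
have {}mP t : u <= t <= v -> f m <= f t by move=> ?; apply: mP; rewrite in_itv.
have {}MP t : u <= t <= v -> f t <= f M by move=> ?; apply: MP; rewrite in_itv.
have fmu : f m = f u.
  have [->//|mu] := eqVneq m u; have [->//|mv'] := eqVneq m v.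
  by exfalso; apply: (@noext m); [rewrite !lt_neqAle um mv mv' eq_sym mu|right].
have fMu : f M = f u.
  have [->//|Mu] := eqVneq M u; have [->//|Mv'] := eqVneq M v.
  by exfalso; apply: (@noext M); [rewrite !lt_neqAle uM Mv Mv' eq_sym Mu|left].
have fconst t : u <= t <= v -> f t = f u.
  move=> tuv; apply/eqP; rewrite eq_le; apply/andP; split.
    by rewrite -fMu; exact: MP.
  by rewrite -fmu; exact: mP.
have [|||t /andP[t1 t2] /eqP] := @transitive_nonconstant u v; try lra.
by rewrite !fconst//; apply/andP; split; lra.
Qed.

End dynamics.


(** * Counting preimages and separated sets *)

Section counting.
Context (R : realType) (f : R -> R).
Context (fc : continuous f).
Context (fI : forall t, unit_interval R t -> unit_interval R (f t)).
Context (ft : topologically_transitive (unit_interval R) f).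
Context (fpm : piecewise_monotone f).

Local Notation I := (unit_interval R).

Definition crits (n : nat) : set R :=
  [set t | I t /\ exists2 j, (j <= n)%N & Crit f (iter j f t)].

Definition preims (n : nat) (y : R) : set R :=
  I `&` iter n f @^-1` [set y].

Lemma Crit_unit t : Crit f t -> I t.
Proof. by case=> [[->|->]|[]//]; rewrite unit_intervalE ?lexx ler01. Qed.

Lemma Crit_crits n t : Crit f t -> crits n t.
Proof. by move=> Ct; split; [exact: Crit_unit|exists 0%N]. Qed.

Lemma crits1 n : crits n 1.
Proof. by apply: Crit_crits; left; right. Qed.

(** Induction on [k]: a critical point strictly between [f^k u] and [f^k v] would be hit at time [k]
    by a point of []u, v[], which would then be in [crits n]. So [f] is injective between these
    values. Only visits to [Crit f] at times below [k] matter, hence the range up to [n.+1]. *)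
Lemma crits_inj n k (a b : R) : (k <= n.+1)%N -> 0 <= a -> b <= 1 ->
  (forall t, a < t < b -> ~ crits n t) -> {in `[a, b] &, injective (iter k f)}.
Proof.
move=> kn a0 b1 nD; elim: k kn => [|k IH] kn; first by move=> u v.
have {}IH := IH (ltnW kn); apply: itv_inj => u v au uv vb /= fuv.
have iuv : {in `[u, v] &, injective (iter k f)}.
  by move=> s t; rewrite !in_itv/= => /andP[? ?] /andP[? ?];
    apply: IH; rewrite in_itv/=; apply/andP; split; lra.
have Iu : I u by rewrite unit_intervalE; lra.
have Iv : I v by rewrite unit_intervalE; lra.
have := iter_unit fI k Iu; have := iter_unit fI k Iv; rewrite !unit_intervalE.
have uI : u \in `[u, v] by rewrite in_itv/= lexx ltW.
have vI : v \in `[u, v] by rewrite in_itv/= lexx ltW.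
have noC t : (iter k f u < t < iter k f v) \/ (iter k f v < t < iter k f u) ->
    ~ Crit f t.
  move=> Ht Ct.
  have [|w /andP[uw wv] wt] := @IVT_continuous _ (iter k f) u v t
      (@iter_continuous _ _ fc k) (ltW uv).
    by case: Ht => /andP[/ltW -> /ltW ->]; [left|right].
  have [uwE|uw'] := eqVneq u w.
    by move: Ht; rewrite -wt uwE ltxx andbF; case.
  have [vwE|vw'] := eqVneq v w.
    by move: Ht; rewrite -wt vwE ltxx andbF; case.
  have {}uw : u < w by rewrite lt_neqAle uw' uw.
  have {}wv : w < v by rewrite lt_neqAle eq_sym vw' wv.
  apply: (nD w); first by lra.
  by split; [rewrite unit_intervalE; lra|exists k; rewrite ?wt//].
move=> /andP[v0 v1] /andP[u0 u1].
have E : iter k f u = iter k f v.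
  have [luv|lvu|//] := ltgtP (iter k f u) (iter k f v).
    have := @Crit_free_inj _ _ fc ft _ _ u0 v1 (fun t H => noC t (or_introl H)).
    by move=> /(_ (iter k f u) (iter k f v)); rewrite !in_itv/= !lexx ltW// => ->.
  have := @Crit_free_inj _ _ fc ft _ _ v0 u1 (fun t H => noC t (or_intror H)).
  by move=> /(_ (iter k f u) (iter k f v)); rewrite !in_itv/= !lexx ltW// => ->.
by have := iuv u v uI vI E => uvE; rewrite uvE ltxx in uv.
Qed.

Lemma crits_inj_eq n k (z z' e : R) : (k <= n.+1)%N -> I z -> I z' -> e <= 1 ->
  z <= e -> z' <= e ->
  (forall t, z < t < e -> ~ crits n t) -> (forall t, z' < t < e -> ~ crits n t) ->
  iter k f z = iter k f z' -> z = z'.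
Proof.
rewrite !unit_intervalE => kn /andP[z0 _] /andP[z'0 _] e1 ze z'e nz nz' E.
have [zz'|z'z] := leP z z'.
  by apply: (crits_inj kn z0 e1 nz) => //; rewrite in_itv/=; lra.
by apply: (crits_inj kn z'0 e1 nz') => //; rewrite in_itv/=; lra.
Qed.

(** By [crits_inj_eq], a point of the preimage is determined by its image in [Q] and by the right
    end, in [crits n], of its gap. *)
Lemma card_preim n k (Q : set R) : finite_set (crits n) -> (k <= n.+1)%N ->
  finite_set Q -> finite_set (I `&` iter k f @^-1` Q) /\
  (ncard (I `&` iter k f @^-1` Q) <= ncard (crits n) * ncard Q)%N.
Proof.
move=> fD kn fQ.
pose r (z : R) (p : R * R) := [/\ z <= p.1,
  (forall s, z <= s < p.1 -> ~ crits n s) & iter k f z = p.2].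
have [|z [Iz /= Qz]|z z' [b q] [Iz _] [Iz' _] [/= Db _] []/= zb nz zq
    [/= z'b nz' z'q]|fA cA] :=
    @ncard_le_rel _ _ (I `&` iter k f @^-1` Q) (crits n `*` Q) r.
- exact: finite_setX.
- have z1 : z <= 1 by move: Iz; rewrite unit_intervalE => /andP[].
  have [b Db [zb nb]] := finite_next fD (crits1 n) z1.
  by exists (b, iter k f z).
- apply: (crits_inj_eq (n := n) (k := k) (e := b)) => //.
  + by move: Db => [+ _]; rewrite unit_intervalE => /andP[].
  + by move=> t /andP[/ltW zt tb]; apply: nz; rewrite zt.
  + by move=> t /andP[/ltW zt tb]; apply: nz'; rewrite zt.
  + by rewrite zq.
- by split=> //; apply: (leq_trans cA); exact: ncard_setX.
Qed.

Lemma finite_crits n : finite_set (crits n).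
Proof.
elim: n => [|n IH].
  by apply: sub_finite_set fpm => t [_ [[|j]//]].
(* [card_preim] reaches [k = n.+1] from the finiteness of [crits n] alone, which lets the induction
   advance. *)
have [fA _] := card_preim IH (leqnn _) fpm.
apply: (@sub_finite_set _ _ (crits n `|` (I `&` iter n.+1 f @^-1` Crit f))).
  move=> t [It [j]]; rewrite leq_eqVlt => /orP[/eqP -> ?|jn ?]; first by right.
  by left; split => //; exists j.
by rewrite finite_setU.
Qed.

Lemma finite_preims n y : finite_set (preims n y).
Proof.
exact: (card_preim (finite_crits n) (leqnSn n) (finite_set1 y)).1.
Qed.

Lemma card_crits_gt0 n : (0 < ncard (crits n))%N.
Proof. by apply: ncard_gt0; [exact: finite_crits|exists 1; exact: crits1]. Qed.

(** A point hitting [Crit f] only after time [m] has its [f^m]-image in [crits n], and [card_preim]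
    counts such points. The factor 2 also covers the points of [crits m] themselves, since [crits n]
    is nonempty. *)
Lemma card_critsD m n :
  (ncard (crits (m + n)) <= 2 * (ncard (crits m) * ncard (crits n)))%N.
Proof.
have [fA cA] := card_preim (finite_crits m) (leqnSn m) (finite_crits n).
have H : crits (m + n) `<=` crits m `|` (I `&` iter m f @^-1` crits n).
  move=> t [It [j jmn Cj]]; have [jm|mj] := leqP j m.
    by left; split => //; exists j.
  right; split => //; split; first exact: iter_unit.
  by exists (j - m)%N; [lia|rewrite -iterD subnK// ltnW].
apply: (leq_trans (ncard_sub _ H)).
  by rewrite finite_setU; split => //; exact: finite_crits.
apply: (leq_trans (ncard_setU (finite_crits m) fA)).
rewrite mul2n -addnn leq_add// leq_pmulr//; exact: card_crits_gt0.
Qed.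

(** Follow [f^n] on the branch to the right of a preimage [z] of [c], up to its end [b]. If it
    reaches [y1] or [y2], record a point where it does; otherwise [f^n b] lies in []y1, y2[], and
    the hypothesis on critical orbits puts [b] in [crits (n - K)]. *)
Lemma card_preims_le n K (y1 c y2 : R) : y1 < c < y2 ->
  (forall i, (i <= K)%N -> forall c', Crit f c' ->
     y1 < iter i f c' < y2 -> iter i f c' = c) ->
  (ncard (preims n c) <=
     1 + ncard (preims n y1) + ncard (preims n y2) + ncard (crits (n - K)))%N.
Proof.
move=> /andP[y1c cy2] HK.
pose B := [set 1] `|` preims n y1 `|` preims n y2 `|` crits (n - K).
have fB1 : finite_set ([set 1] `|` preims n y1).
  by rewrite finite_setU; split => //; exact: finite_preims.
have fB2 : finite_set ([set 1] `|` preims n y1 `|` preims n y2).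
  by rewrite finite_setU; split => //; exact: finite_preims.
have fB : finite_set B by rewrite finite_setU; split => //; exact: finite_crits.
have cB : (ncard B <=
     1 + ncard (preims n y1) + ncard (preims n y2) + ncard (crits (n - K)))%N.
  apply: (leq_trans (ncard_setU fB2 (finite_crits _))); rewrite leq_add2r.
  apply: (leq_trans (ncard_setU fB1 (finite_preims _ _))); rewrite leq_add2r.
  apply: (leq_trans (ncard_setU (finite_set1 _) (finite_preims _ _))).
  by rewrite leq_add2r /ncard fset_set1 cardfs1.
apply: leq_trans cB.
(* The gap is open at [z], because [z] may itself lie in [crits n]. The point 1, with no branch to
   its right, records itself. *)
pose r (z e : R) := [/\ z <= e, e <= 1 & forall s, z < s < e -> ~ crits n s].
have [z [Iz /= zc]|z z' e [Iz /= zc] [Iz' /= z'c] _ [ze e1 nz] [z'e _ nz']|] :=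
    @ncard_le_rel _ _ (preims n c) B r fB; last by [].
- have [/andP[z0 z1]] : 0 <= z <= 1 by rewrite -unit_intervalE.
  have [->|z1'] := eqVneq z 1.
    by exists 1; [do 3 left|split => // s; rewrite lt_asym].
  have {z1' z1}z1 : z < 1 by rewrite lt_neqAle z1'.
  have [||b [Db /= zb] [_ nb]] :=
      @finite_next _ (crits n `&` [set t | z < t]) z 1 _ _ (ltW z1).
  + by apply: finite_setIl; exact: finite_crits.
  + by split => //; exact: crits1.
  have b1 : b <= 1 by move: Db => [+ _]; rewrite unit_intervalE => /andP[].
  have {}nb s : z < s < b -> ~ crits n s.
    by move=> /andP[zs sb] Ds; apply: (nb s) => //; rewrite ltW.
  have Ibet w : z <= w <= b -> I w by rewrite unit_intervalE; lra.
  have rbet w : z <= w <= b -> r z w.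
    move=> /andP[zw wb]; split => //; first lra.
    by move=> s /andP[zs sw]; apply: nb; rewrite zs; lra.
  have bI : z <= b <= b by rewrite ltW//=.
  have fbc : iter n f b != c.
    apply/eqP => fbc; have zbE : z = b; last by rewrite zbE ltxx in zb.
    by apply: (crits_inj (leqnSn n) z0 b1 nb); rewrite ?in_itv/= ?lexx ?ltW// zc.
  have fnc := @iter_continuous _ _ fc n.
  have [y1b|by1] := ltP y1 (iter n f b); last first.
    have [|w wzb wy] := @IVT_continuous _ (iter n f) z b y1 fnc (ltW zb).
      by right; rewrite by1 zc ltW.
    by exists w; [left; left; right; split => //; exact: Ibet|exact: rbet].
  have [yb2|b2y] := ltP (iter n f b) y2; last first.
    have [|w wzb wy] := @IVT_continuous _ (iter n f) z b y2 fnc (ltW zb).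
      by left; rewrite b2y zc ltW.
    by exists w; [left; right; split => //; exact: Ibet|exact: rbet].
  exists b; last exact: rbet.
  right; case: Db => Ib [j jn Cj]; split => //; exists j => //.
  (* If the visit came after time [n - K], at most [K] further steps would lead the critical point
     [f^j b] into []y1, y2[], hence to [c], against [fbc]. *)
  have [jK|Kj] := leqP j (n - K) => //; exfalso.
  have E : iter (n - j) f (iter j f b) = iter n f b by rewrite -iterD subnK.
  have := HK (n - j)%N _ _ Cj; rewrite E y1b yb2 => /(_ _ isT) H.
  by move/eqP: fbc; apply; apply: H; lia.
- apply: (crits_inj_eq (n := n) (k := n) (e := e)) => //.
  by rewrite zc.
Qed.

(** A point of [E] is recorded by the right end of its gap and by the integer part of [Phi / eps].
    The latter is at most that of [n / eps], because each term of [Phi] is at most 1. *)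
Lemma card_separated n (eps : R) (E : set R) : 0 < eps ->
  Defs.separated I f n eps E -> finite_set E /\
  (ncard E <= ncard (crits n) * (Num.truncn (n%:R / eps)).+1)%N.
Proof.
move=> eps0 [EI Esep]; set N := Num.truncn _.
(* Along a gap each f^k is monotone, so [Phi z b] drops by more than [eps] between
   separated points. *)
pose Phi (z b : R) : R := \sum_(k < n) `|iter k f z - iter k f b|.
have Phi0 z b : 0 <= Phi z b by apply: sumr_ge0.
pose r (z : R) (p : R * nat) := [/\ z <= p.1,
  (forall s, z <= s < p.1 -> ~ crits n s) & p.2 = Num.truncn (Phi z p.1 / eps)].
have tP (x : R) : 0 <= x -> (Num.truncn x)%:R <= x < (Num.truncn x).+1%:R.
  by move=> x0; exact: truncn_itv.
have key z z' b : E z -> E z' -> z < z' -> z' <= b -> crits n b ->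
    (forall s, z <= s < b -> ~ crits n s) -> Phi z' b + eps < Phi z b.
  move=> Ez Ez' zz' z'b Db nz.
  have zz'n : z <> z' by move=> zE; rewrite zE ltxx in zz'.
  have [k kn] := Esep z z' Ez Ez' zz'n.
  have b1 : b <= 1 by move: Db => [+ _]; rewrite unit_intervalE => /andP[].
  have z0 : 0 <= z by move: (EI _ Ez); rewrite unit_intervalE => /andP[].
  have step j : (j < n)%N -> `|iter j f z - iter j f b| =
      `|iter j f z' - iter j f b| + `|iter j f z - iter j f z'|.
    move=> jn; have inj : {in `[z, b] &, injective (iter j f)}.
      apply: (crits_inj (n := n)) => //; first by lia.
      by move=> t /andP[/ltW zt tb]; apply: nz; rewrite zt.
    have zz'b : z <= z' <= b by rewrite ltW.
    have [/andP[h1 h2]|/andP[h1 h2]] :=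
      inj_between (@iter_continuous _ _ fc j) zz'b inj.
      by rewrite !ler0_norm; lra.
    by rewrite !ger0_norm; lra.
  have -> : Phi z b = Phi z' b + \sum_(j < n) `|iter j f z - iter j f z'|.
    by rewrite -big_split/=; apply: eq_bigr => j _; exact: step.
  rewrite ltrD2l => /lt_le_trans; apply.
  rewrite (bigD1 (Ordinal kn))//= lerDl; exact: sumr_ge0.
have sep z z' b : E z -> E z' -> z < z' -> z' <= b -> crits n b ->
    (forall s, z <= s < b -> ~ crits n s) ->
    Num.truncn (Phi z b / eps) <> Num.truncn (Phi z' b / eps).
  move=> Ez Ez' zz' z'b Db nz E0.
  have := key _ _ _ Ez Ez' zz' z'b Db nz.
  have /andP[_ h1] := tP _ (divr_ge0 (Phi0 z b) (ltW eps0)).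
  have /andP[h2 _] := tP _ (divr_ge0 (Phi0 z' b) (ltW eps0)).
  rewrite E0 -natr1 in h1.
  have : Phi z b / eps < Phi z' b / eps + 1 by apply: (lt_le_trans h1); rewrite lerD2r.
  by rewrite ltr_pdivrMr// mulrDl mul1r divfK ?gt_eqF//; lra.
have [|z Ez|z z' [b m] Ez Ez' [/= Db _] []/= zb nz zq
    [/= z'b nz' z'q]|fA cA] :=
    @ncard_le_rel _ _ E (crits n `*` `I_N.+1) r.
- by apply: finite_setX; [exact: finite_crits|exact: finite_II].
- have Iz := EI _ Ez.
  have z1 : z <= 1 by move: Iz; rewrite unit_intervalE => /andP[].
  have [b Db [zb nb]] := finite_next (finite_crits n) (crits1 n) z1.
  exists (b, Num.truncn (Phi z b / eps)) => //; split => //=.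
  have /andP[h1 _] := tP _ (divr_ge0 (Phi0 z b) (ltW eps0)).
  have n0 : 0 <= n%:R / eps by rewrite divr_ge0// ltW.
  have /andP[_ h2] := tP _ n0.
  rewrite -(ltr_nat R); apply: (le_lt_trans h1); apply: le_lt_trans h2.
  rewrite ler_pM2r ?invr_gt0//.
  apply: (@le_trans _ _ (\sum_(k < n) 1)); last by rewrite sumr_const card_ord.
  apply: ler_sum => k _; have := iter_unit fI k Iz.
  have := iter_unit fI k Db.1; rewrite !unit_intervalE ler_norml; lra.
- have [zz'|z'z|//] := ltgtP z z'; exfalso.
    by apply: (sep z z' b) => //; rewrite -zq -z'q.
  by apply: (sep z' z b) => //; rewrite -zq -z'q.
- split=> //; apply: (leq_trans cA); apply: leq_trans (ncard_setX _ _) _.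
  + exact: finite_crits.
  + exact: finite_II.
  by rewrite leq_mul2l /ncard (card_fset_set (card_eqxx _)) leqnn orbT.
Qed.

End counting.


(** Unoriented, because [f] may reverse the order of points. *)
Definition between (R : realType) (u v t : R) : Prop := u <= t <= v \/ v <= t <= u.

Lemma betweenC (R : realType) (u v t : R) : between u v t -> between v u t.
Proof. by case; [right|left]. Qed.

Lemma between_image (R : realType) (g : R -> R) (u v t : R) :
  continuous g -> between u v t ->
  (forall a b, (forall s, a <= s <= b -> between u v s) -> {in `[a, b] &, injective g}) ->
  between (g u) (g v) (g t).
Proof.
move=> gc; case=> H gi; last apply: betweenC.
  by apply: inj_between => //; apply: gi => s ?; left.
by apply: inj_between => //; apply: gi => s ?; right.
Qed.

Lemma closed_preimage_continuous (R : realType) (g : R -> R) (A : set R) :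
  continuous g -> closed A -> closed (g @^-1` A).
Proof. by move=> gc; apply: preimage_closed => t _; exact: gc. Qed.

(** * Density of backward orbits *)

Section exceptional.
Context (R : realType) (f : R -> R).
Context (fc : continuous f).
Context (fI : forall t, unit_interval R t -> unit_interval R (f t)).
Context (ft : topologically_transitive (unit_interval R) f).
Context (fpm : piecewise_monotone f).

Local Notation I := (unit_interval R).

(* A point outside F whose orbit stays eps-close to F would, by monotonicity near
   F, come with an interval of such points, which transitivity forbids. So every
   point outside F leaves the eps-neighbourhood, in uniformly bounded time on
   compact sets; then orbits starting away from F never accumulate at F. *)
Lemma no_finite_backward_invariant (F : set R) : finite_set F -> F `<=` I ->
  (forall t, I t -> F (f t) <-> F t) -> F = set0.
Proof.
move=> fF FI Ff; apply: contrapT => /eqP/set0P[b0 Fb0].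
have Fiter n t : I t -> F (iter n f t) <-> F t.
  move=> It; elim: n => //= n IH; rewrite Ff//; exact: iter_unit.
have [rho rho0 Frho] : exists2 e, 0 < e &
    forall b, F b -> forall c, F c -> c != b -> e < `|c - b|.
  apply: finite_uniform_radius => // [b _|b e e' _ _ ee' H c Fc cb].
    exact: finite_isolated.
  by apply: le_lt_trans ee' _; exact: H.
have [z z01 nFz] : exists2 z : R, 0 < z < 1 & ~ F z by exact: finite_avoid.
have Iz : I z by rewrite unit_intervalE; lra.
have [e1 e10 e1P] : exists2 e, 0 < e & forall b, F b ->
    forall t, `|t - b| <= e -> `|f t - f b| <= rho / 2.
  apply: finite_uniform_radius => // [b _|b e e' _ _ ee' H t te]; last first.
    by apply: H; exact: le_trans ee'.
  have /cvgrPdist_lt := @fc b => /(_ (rho / 2)).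
  rewrite divr_gt0// => /(_ isT)/nbhs_ballP[e /= e0 eP].
  exists (e / 2); first by rewrite divr_gt0.
  move=> t te; rewrite distrC ltW//; apply: eP.
  by rewrite /ball /= distrC; lra.
have [e2 e20 e2P] : exists2 e, 0 < e & forall b, F b ->
    forall c, Crit f c -> c != b -> e < `|c - b|.
  apply: finite_uniform_radius => // [b _|b e e' _ _ ee' H c Fc cb].
    exact: finite_isolated.
  by apply: le_lt_trans ee' _; exact: H.
have [e3 e30 e3P] := finite_isolated z fF.
have {}e3P b : F b -> e3 < `|z - b|.
  by move=> Fb; rewrite distrC; apply: e3P => //; apply: contra_notN nFz => /eqP <-.
(* With this [eps], points [eps]-close to some [b] in [F] have images [rho / 2]-close to [f b], no
   critical point other than [b] is [eps]-close to [b], and [z] stays outside the neighbourhood [N]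
   of [F]. *)
pose eps := Num.min (rho / 2) (Num.min e1 (Num.min e2 e3)).
have eps0 : 0 < eps by rewrite !lt_min e10 e20 e30 divr_gt0.
have epsrho : eps <= rho / 2 by rewrite ge_min lexx.
have eps1 : eps <= e1 by rewrite !ge_min lexx orbT.
have eps2 : eps <= e2 by rewrite !ge_min lexx !orbT.
have eps3 : eps <= e3 by rewrite !ge_min lexx !orbT.
pose N : set R := \bigcup_(b in F) [set t | `|t - b| <= eps].
have Nc : closed N.
  apply: closed_bigcup => // b _.
  have -> : [set t | `|t - b| <= eps] = `[b - eps, b + eps]%classic.
    by apply/seteqP; split => t /=; rewrite in_itv/= ler_norml; lra.
  exact: itv_closed.
have nNz : ~ N z.
  by move=> [b /e3P zb /=]; rewrite leNgt (le_lt_trans eps3).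
pose A : set R := \bigcap_(i in setT) (iter i f @^-1` N).
have Ac : closed A.
  by apply: closed_bigI => i _; apply: closed_preimage_continuous => //;
    exact: iter_continuous.
have Af t : A t -> A (f t).
  by move=> At i _; have := At i.+1 Logic.I; rewrite /= -iterSr.
have local b t y : F b -> I y -> `|y - b| <= eps -> between b y t ->
    between (f b) (f y) (f t).
  move=> Fb Iy yb bt; apply: between_image => // u v uvP.
  have [vu|uv] := ltP v u.
    by move=> s s'; rewrite in_itv/= => h; exfalso; lra.
  have Ib := FI _ Fb; move: Ib Iy; rewrite !unit_intervalE => Ib Iy.
  have uP : between b y u by apply: uvP; rewrite lexx.
  have vP : between b y v by apply: uvP; rewrite lexx andbT.
  have [u0 v1] : 0 <= u /\ v <= 1 by case: uP; case: vP; lra.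
  apply: (Crit_free_inj fc ft) => // s suv Cs.
  have sP : between b y s by apply: uvP; lra.
  have sb : s != b by apply/eqP => sb; case: uP; case: vP; lra.
  have := e2P _ Fb _ Cs sb; rewrite ltr_normr => /orP H.
  by move: yb; rewrite ler_norml; case: H; case: sP; lra.
have leave y : I y -> ~ F y -> ~ A y.
  move=> Iy nFy Ay.
  have [b Fb /= yb] := Ay 0%N Logic.I.
  have by' : b != y by apply/eqP => by_; apply: nFy; rewrite -by_.
  have Fi i : F (iter i f b) by apply/Fiter => //; exact: FI.
  (* The point of [F] that is [eps]-close to the next iterate of [y] is within [rho] of the next
     iterate of [b], and distinct points of [F] are further apart. So [y] shadows [b]. *)
  have yi i : `|iter i f y - iter i f b| <= eps.
    elim: i => [//|i IH] /=.
    have h1 : `|f (iter i f y) - f (iter i f b)| <= rho / 2.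
      by apply: e1P => //; exact: le_trans eps1.
    have [b' Fb' /= b'P] := Ay i.+1 Logic.I.
    have [<-//|b'n] := eqVneq b' (f (iter i f b)).
    have := Frho _ (Fi i.+1) _ Fb' b'n; rewrite ltr_normr => /orP H.
    by move: h1 b'P; rewrite !ler_norml /=; case: H => /=; lra.
  have bet t : between b y t -> forall i, between (iter i f b) (iter i f y) (iter i f t).
    move=> tb; elim=> [//|i IH] /=.
    exact: (local _ _ _ (Fi i) (iter_unit fI i Iy) (yi i) IH).
  (* Points between [b] and [y] are squeezed between the two orbits and remain in [N]. They fill an
     interval inside the closed invariant set [A], which would thus contain [z]. *)
  have At t : between b y t -> A t.
    move=> tP i _; exists (iter i f b) => //=.
    by move: (yi i) (bet t tP i); rewrite !ler_norml => ? []; lra.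
  have Ib := FI _ Fb; move: Ib Iy; rewrite !unit_intervalE => Ib Iy.
  have IA : I `<=` A.
    have [bly|ylb|E] := ltgtP b y.
    - apply: (transitive_invariant fI ft Ac _ _ bly); [by move=> t _; exact: Af|lra|lra|].
      by move=> t /andP[/ltW ? /ltW ?]; apply: At; left; apply/andP.
    - apply: (transitive_invariant fI ft Ac _ _ ylb); [by move=> t _; exact: Af|lra|lra|].
      by move=> t /andP[/ltW ? /ltW ?]; apply: At; right; apply/andP.
    - by rewrite E eqxx in by'.
  by apply: nNz; have := IA _ Iz 0%N Logic.I.
pose U : set R := ~` N.
have Uo : open U by exact: closed_openC.
have Ic : compact I by exact: segment_compact.
pose K0 : set R := I `&` closure U.
have K0c : compact K0 by apply: compact_closedI => //; exact: closed_closure.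
have UK0 t : I t -> U t -> K0 t by move=> It Ut; split => //; exact: subset_closure.
have K0F b : F b -> ~ K0 b.
  move=> Fb [_ /(_ (ball b eps))[]]; first exact: nbhsx_ballx.
  by move=> t [nNt bt]; apply: nNt; exists b => //=; rewrite distrC ltW.
(* With the image of [K0] included, an orbit in [I] that visits [U] has its next point in [K]; this
   makes [B] below invariant. *)
pose K : set R := K0 `|` f @` K0.
have Kc : compact K.
  apply: compactU => //; apply: continuous_compact => //.
  exact: continuous_subspaceT.
have KI t : K t -> I t by case=> [[]//|[u [Iu _] <-]]; exact: fI.
have KF b : F b -> ~ K b.
  move=> Fb [|[u K0u fub]]; first exact: K0F.
  by apply: (K0F u) => //; apply/Ff; [exact: K0u.1|rewrite fub].
(* By compactness the time to enter [U] is bounded on [K], since no point of [K] stays in [N]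
   forever. *)
have [n0 n0P] : exists n0, forall k, K k -> exists2 i, (i <= n0)%N & U (iter i f k).
  have := Kc; rewrite compact_cover => /(_ nat setT (fun i => iter i f @^-1` U)).
  case.
  - by move=> i _; apply: open_comp => // t _; exact: iter_continuous.
  - move=> k Kk; apply: contrapT => nk.
    have nFk : ~ F k by move=> Fk; exact: (KF _ Fk).
    apply: (leave _ (KI _ Kk) nFk) => i _ /=; apply: contrapT => nNi.
    by apply: nk; exists i.
  - move=> D _ KD; exists (\max_(i <- D) i) => k /KD[i /= iD Ui].
    by exists i => //; exact: (@leq_bigmax_seq _ _ xpredT id).
pose B : set R := \bigcup_(i in `I_n0.+1) (iter i f @` K).
have Bc : closed B.
  apply: closed_bigcup; first exact: finite_II.
  move=> i _; apply: compact_closed; first exact: Rhausdorff.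
  apply: continuous_compact => //; apply: continuous_subspaceT.
  exact: iter_continuous.
have Bf t : B t -> B (f t).
  move=> [i /= ilt [k Kk <-]]; have [ilt'|ige] := ltnP i n0.
    by exists i.+1 => //=; exists k.
  (* At the last index the orbit of [k] has already visited [U] at some time [j <= n0], so the count
     restarts from [f^j.+1 k], again a point of [K]. *)
  have -> : i = n0 by lia.
  have [j jn0 Uj] := n0P k Kk.
  exists (n0 - j)%N; first by rewrite /=; lia.
  exists (iter j.+1 f k); last by rewrite -iterD addnS subnK.
  right; exists (iter j f k) => //; apply: UK0 => //; apply: iter_unit => //.
  exact: KI.
have BF b : F b -> ~ B b.
  move=> Fb [i _ [k Kk E]]; apply: (KF k) => //.
  by apply/(Fiter i _ (KI _ Kk)); rewrite E.
have IB : I `<=` B.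
  have /nbhs_ballP[e /= e0 eU] : nbhs z U by apply: open_nbhs_nbhs.
  have zm : z < Num.min 1 (z + e) by rewrite lt_min; lra.
  apply: (transitive_invariant fI ft Bc _ _ zm); [by move=> t _; exact: Bf|lra| |].
    by rewrite ge_min lexx.
  move=> t; rewrite lt_min => /andP[zt /andP[t1 te]].
  exists 0%N => //; exists t => //; left; apply: UK0.
    by rewrite unit_intervalE; lra.
  by apply: eU; rewrite /ball/= ltr_norml; lra.
by apply: (BF _ Fb0); apply: IB; exact: FI.
Qed.

End exceptional.


Lemma is_interval_image (R : realType) (g : R -> R) (A : set R) :
  continuous g -> is_interval A -> is_interval (g @` A).
Proof.
move=> gc iA _ _ [a Aa <-] [b Ab <-] v gv.
have [ab|ba] := leP a b.
  have [|c cab <-] := IVT_continuous gc ab (v := v); first by left.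
  by exists c => //; exact: iA cab.
have [|c cab <-] := IVT_continuous gc (ltW ba) (v := v); first by right.
by exists c => //; exact: iA cab.
Qed.

Section backward_orbits.
Context (R : realType) (f : R -> R).
Context (fc : continuous f).
Context (fI : forall t, unit_interval R t -> unit_interval R (f t)).
Context (ft : topologically_transitive (unit_interval R) f).
Context (fpm : piecewise_monotone f).

Local Notation I := (unit_interval R).

(* If f^n V meets V, the union of the f^(n k) V is an interval Y, and the orbit of V
   is the dense union of the intervals f^i Y, i < n: it can only miss 0 and the
   suprema of these intervals. *)
Lemma finite_complement_orbit (a b : R) : 0 <= a -> a < b -> b <= 1 ->
  finite_set (I `\` [set w | exists m, exists2 t, a < t < b & iter m f t = w]).
Proof.
move=> a0 ab b1; set hit := [set w | _].
pose V : set R := `]a, b[%classic.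
have VE t : V t = (a < t < b) by rewrite /V /= in_itv.
have Vi : is_interval V by exact: interval_is_interval.
have [||||n n1 [_ [[t0 [Vt0 It0] <-]] [Vs0 _]]] := @ft V V.
- exact: itv_open.
- exact: itv_open.
- exact: unit_itv_meet.
- exact: unit_itv_meet.
set s0 := iter n f t0 in Vs0.
pose Z k : set R := iter (n * k) f @` V.
have Zi k : is_interval (Z k).
  by apply: is_interval_image => //; exact: iter_continuous.
pose Y : set R := \bigcup_k Z k.
(* Consecutive intervals [Z k] and [Z k.+1] share the point [f^(n k) s0], so induction on [k] joins
   [s0] to every point of [Z k] within [Y]. *)
have Ys0 k w v : Z k w -> between s0 w v -> Y v.
  elim: k w v => [|k IH] w v Zw sv.
    have Zs0 : Z 0%N s0 by exists s0; rewrite ?muln0.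
    by exists 0%N => //; case: sv => sv; [exact: Zi sv|exact: Zi sv].
  pose p := iter (n * k) f s0.
  have Zkp : Z k p by exists s0.
  have Zk1p : Z k.+1 p by exists t0 => //; rewrite /p /s0 -iterD mulnS addnC.
  have [/(IH _ _ Zkp)//|nb] := pselect (between s0 p v).
  exists k.+1 => //; have [pwv|wpv] : between p w v.
  - case: sv => sv; have [vp|pv] := leP v p; have [vs|sv'] := leP v s0;
      have [vw|wv] := leP v w;
      first [by left; lra|by right; lra
            |by exfalso; apply: nb; left; lra|by exfalso; apply: nb; right; lra].
  - exact: Zi pwv.
  - exact: Zi wpv.
have Yi : is_interval Y.
  move=> w1 w2 [k1 _ Z1] [k2 _ Z2] v /andP[v1 v2].
  have [vs|sv] := leP v s0; last by apply: (Ys0 k2 w2) => //; left; lra.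
  by apply: (Ys0 k1 w1) => //; right; lra.
pose J i : set R := iter i f @` Y.
have Ji i : is_interval (J i).
  by apply: is_interval_image => //; exact: iter_continuous.
have Jhit i w : J i w -> hit w.
  by move=> [_ [k _ [t Vt <-]] <-]; exists (i + n * k)%N, t; rewrite ?iterD// -VE.
have hitJ w : hit w -> exists2 i, (i < n)%N & J i w.
  move=> [m [t tab <-]]; exists (m %% n)%N; first by rewrite ltn_mod.
  exists (iter (n * (m %/ n)) f t); last by rewrite -iterD mulnC addnC -divn_eq.
  by exists (m %/ n)%N => //; exists t => //; rewrite VE.
have VI t : V t -> I t by rewrite VE unit_intervalE; lra.
have JI i w : J i w -> I w.
  by move=> [_ [k _ [t Vt <-]] <-]; do 2 apply: iter_unit => //; exact: VI.
apply: (@sub_finite_set _ _ ([set 0] `|` (fun i => sup (J i)) @` `I_n)); last first.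
  rewrite finite_setU; split; first exact: finite_set1.
  by apply: finite_image; exact: finite_II.
move=> z [Iz nz]; apply: contrapT => /not_orP[/= z0 nsup].
have {}z0 : 0 < z.
  by move: Iz; rewrite unit_intervalE lt_def => /andP[-> _]; rewrite andbT; apply/eqP.
(* An interval [J i] with a point above [z] has none below, else [z] would be hit. One with no point
   above [z] has its supremum strictly below [z]. Either way it misses a left neighbourhood of [z],
   which transitivity forbids. *)
have [e e0 eP] : exists2 e, 0 < e & forall i, `I_n i ->
    forall w, J i w -> ~ (z - e < w < z).
  apply: finite_uniform_radius; first exact: finite_II.
    move=> i /= ilt; have [[w0 Jw0 zw0]|nw] := pselect (exists2 w, J i w & z < w).
      exists 1 => // w Jw /andP[_ wz]; apply: nz; apply: (Jhit i).
      by apply: Ji Jw Jw0 _ _; rewrite !ltW.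
    have Jz w : J i w -> w <= z.
      by move=> Jw; rewrite leNgt; apply/negP => zw; apply: nw; exists w.
    have J0 : J i !=set0.
      by exists (iter i f s0), s0 => //; exists 0%N => //; exists s0; rewrite ?muln0.
    have sz : sup (J i) < z.
      rewrite lt_neqAle ge_sup// andbT; apply/eqP => E.
      by apply: nsup; exists i.
    exists (z - sup (J i)); first by rewrite subr_gt0.
    move=> w Jw; have : w <= sup (J i) by apply: ub_le_sup => //; exists z.
    by move=> ? /andP[]; lra.
  by move=> i e e' _ _ ee' H w Jw wz; apply: (H w Jw); lra.
pose m := Num.max 0 (z - e).
have mz : m < z by rewrite gt_max; lra.
have m0 : 0 <= m by rewrite le_max lexx.
have z1 : z <= 1 by move: Iz; rewrite unit_intervalE; lra.
have [||||k _ [w [[t [Vt _] tw] [+ _]]]] := @ft V `]m, z[%classic.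
- exact: itv_open.
- exact: itv_open.
- exact: unit_itv_meet.
- exact: unit_itv_meet.
rewrite /= in_itv/= gt_max => mwz.
have [i ilt Jw] : exists2 i, (i < n)%N & J i w.
  by apply: hitJ; exists k, t; rewrite -?VE.
by apply: (eP i ilt w Jw); move: mwz; lra.
Qed.

(** The set [F] of points never hit from []a, b[] is finite and contains its preimage [P]. By
    surjectivity [P] has at least as many points as [F], so the two coincide; [F] is then invariant
    both ways, hence empty. *)
Lemma backward_orbit_dense (x a b : R) : I x -> 0 <= a -> a < b -> b <= 1 ->
  exists2 y, a < y < b & exists m, iter m f y = x.
Proof.
move=> Ix a0 ab b1; apply: contrapT => nx.
set hit := [set w | exists m, exists2 t, a < t < b & iter m f t = w].
have fF : finite_set (I `\` hit) by exact: finite_complement_orbit.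
set F := I `\` hit in fF *.
have Fback t : I t -> F (f t) -> F t.
  move=> It [_ nft]; split => // -[m [s sab st]]; apply: nft.
  by exists m.+1, s => //=; rewrite st.
pose P := I `&` f @^-1` F.
have PF : P `<=` F by move=> t [It]; exact: Fback.
have fP : finite_set P by exact: sub_finite_set fF.
have cFP : (ncard F <= ncard P)%N.
  apply: (ncard_le_rel (r := fun u v => f v = u) fP _ _).2.
    move=> u Fu; have [t It ftu] := transitive_surj fc fI ft Fu.1.
    by exists t => //; split => //=; rewrite ftu.
  by move=> t t' u _ _ _ <- <-.
have Fforw t : F t -> F (f t).
  move=> Ft; apply: contrapT => nFt.
  have sub : P `<=` F `\ t.
    by move=> u Pu; split; [exact: PF|move=> /= ut; apply: nFt; rewrite -ut; case: Pu].
  have fFt : finite_set (F `\ t) by exact: finite_setD.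
  have := leq_trans cFP (ncard_sub fFt sub).
  rewrite /ncard fset_setD1// (cardfsD1 t (fset_set F)) in_fset_set// mem_set//.
  by rewrite add1n ltnn.
have F0 : F = set0.
  apply: (no_finite_backward_invariant fc fI ft fpm fF) => [t []//|t It].
  by split; [exact: Fback|exact: Fforw].
have : F x; last by rewrite F0.
by split => // -[m [t tab tx]]; apply: nx; exists t => //; exists m.
Qed.

End backward_orbits.


(** * Upper limits and entropy *)

Section limn_esup.
Context (R : realType).
Implicit Types (u v : (\bar R)^nat) (l : \bar R).

Lemma limn_esup_near_le u l :
  (\forall n \near \oo, (u n <= l)%E) -> (limn_esup u <= l)%E.
Proof.
move=> H; rewrite /limn_esup limf_esupE.
apply: (@le_trans _ _ (ereal_sup (u @` [set n | (u n <= l)%E]))).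
  by apply: ereal_inf_lbound; exists [set n | (u n <= l)%E].
by apply: ge_ereal_sup => _ [n /= ul <-].
Qed.

Lemma limn_esup_lt u l :
  (limn_esup u < l)%E -> \forall n \near \oo, (u n < l)%E.
Proof.
rewrite /limn_esup limf_esupE => /ereal_inf_lt[_ [V VN <-] Vl].
apply: filterS VN => n Vn; apply: le_lt_trans Vl.
by apply: ereal_sup_ubound; exists n.
Qed.

Lemma limn_esup_mono u v :
  (forall n, (u n <= v n)%E) -> (limn_esup u <= limn_esup v)%E.
Proof.
move=> uv; rewrite /limn_esup !limf_esupE; apply: le_ereal_inf_tmp => _ [V VN <-].
apply: (@le_trans _ _ (ereal_sup (u @` V))).
  by apply: ereal_inf_lbound; exists V.
apply: ge_ereal_sup => _ [n Vn <-]; apply: (le_trans (uv n)).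
by apply: ereal_sup_ubound; exists n.
Qed.

Lemma limn_esup_ge u l :
  (forall n, (l <= u n)%E) -> (l <= limn_esup u)%E.
Proof.
move=> lu; rewrite /limn_esup !limf_esupE; apply: le_ereal_inf_tmp => _ [V VN <-].
have [n Vn] := filter_ex VN; apply: (le_trans (lu n)).
by apply: ereal_sup_ubound; exists n.
Qed.

End limn_esup.

Section asymptotics.
Context (R : realType).

Lemma exp_small (z e : R) : 0 <= z < 1 -> 0 < e -> exists k, z ^+ k < e.
Proof.
move=> /andP[z0 z1] e0.
have : `|z| < 1 by rewrite ger0_norm.
move=> /cvg_expr/cvgrPdist_lt/(_ e e0)[k _ kP]; exists k.
have := kP k (leqnn k); rewrite sub0r normrN ger0_norm//; exact: exprn_ge0.
Qed.

(** A bound valid from some time on improves by the factor [theta] once [K] more steps have passed,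
    so [u n <= theta ^+ j * M] from [n0 + j * K] on. *)
Lemma window_decay (u : nat -> R) (theta : R) (K n0 : nat) :
  0 <= theta < 1 -> (0 < K <= n0)%N -> (forall n, 0 <= u n) ->
  (forall n, (n0 <= n)%N -> u n.+1 <= theta * Num.max (u n) (u (n.+1 - K)%N)) ->
  forall e, 0 < e -> exists n, u n < e.
Proof.
move=> t01 /andP[K0 Kn0] u0 uP e e0; have /andP[t0 t1] := t01.
pose M : R := \sum_(i < n0.+1) u i.
have M0 : 0 <= M by apply: sumr_ge0.
have uM n : u n <= M.
  elim/ltn_ind: n => n IH; have [nn0|] := leqP n n0.
    by rewrite /M (bigD1 (Ordinal (nn0 : (n < n0.+1)%N)))//= lerDl sumr_ge0.
  case: n IH => // n IH n0n; apply: (le_trans (uP n n0n)).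
  apply: (@le_trans _ _ (theta * M)); last by rewrite ler_piMl// ltW.
  by rewrite ler_wpM2l// ge_max !IH//; lia.
have uj j n : (n0 + j * K <= n)%N -> u n <= theta ^+ j * M.
  elim: j n => [n _|j IH n]; first by rewrite expr0 mul1r.
  case: n => [|n] nj; first by lia.
  apply: (le_trans (uP n _)); first by lia.
  by rewrite exprS -mulrA ler_wpM2l// ge_max !IH//; lia.
have M1 : 0 < M + 1 by rewrite ltr_wpDl.
have [j jP] := exp_small t01 (divr_gt0 e0 M1).
exists (n0 + j * K)%N; apply: (le_lt_trans (uj j _ (leqnn _))).
apply: (@le_lt_trans _ _ (theta ^+ j * (M + 1))).
  by rewrite ler_wpM2l ?exprn_ge0// lerDl.
by rewrite -ltr_pdivlMr.
Qed.

Lemma finite_eventually (T : Type) (C : set T) (P : T -> nat -> Prop) :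
  finite_set C -> (forall c, C c -> \forall n \near \oo, P c n) ->
  \forall n \near \oo, forall c, C c -> P c n.
Proof.
elim/Pchoice: T => T in C P *.
move=> /finite_seqP[s ->]; elim: s => [|c s IH] H; first by near=> n.
have Hc : \forall n \near \oo, P c n by apply: H; rewrite /= inE eqxx.
have Hs : \forall n \near \oo, forall d, [set` s] d -> P d n.
  by apply: IH => d ds; apply: H; rewrite /= inE; apply/orP; right.
near=> n => d /=; rewrite inE => /orP[/eqP ->|ds].
  by near: n.
by apply: (near Hs n).
Unshelve. all: by end_near. Qed.

End asymptotics.

Section growth.
Context (R : realType) (f : R -> R).
Context (fc : continuous f).
Context (fI : forall t, unit_interval R t -> unit_interval R (f t)).
Context (ft : topologically_transitive (unit_interval R) f).
Context (fpm : piecewise_monotone f).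

Local Notation I := (unit_interval R).

Lemma separated_card_ge0 n (eps : R) : (0 <= separated_card I f n eps)%E.
Proof.
apply: ereal_sup_ubound; exists set0 => /=; first by split.
by rewrite /counting asboolT// fset_set0 cardfs0.
Qed.

Lemma separated_card_le n (eps : R) : 0 < eps -> (separated_card I f n eps <=
  (ncard (crits f n) * (Num.truncn (n%:R / eps)).+1)%N%:R%:E)%E.
Proof.
move=> eps0; apply: ge_ereal_sup => _ [E /= Esep <-].
have [fE cE] := card_separated fc fI ft fpm eps0 Esep.
by rewrite /counting asboolT// lee_fin ler_nat.
Qed.

Lemma separated_cardS n (eps eps' : R) : eps <= eps' ->
  (separated_card I f n eps' <= separated_card I f n eps)%E.
Proof.
move=> ee; apply: le_ereal_sup => _ [E [EI Es] <-]; exists E => //; split => //.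
move=> u v Eu Ev uv; have [k kn H] := Es u v Eu Ev uv.
by exists k => //; exact: le_lt_trans H.
Qed.

Lemma lne_mono (a b : \bar R) : (0 <= a)%E -> (a <= b)%E -> (lne a <= lne b)%E.
Proof.
move=> a0 ab; rewrite lee_lne// in_itv/= ?leey ?andbT//; exact: le_trans ab.
Qed.

(** The gap between [b'] and [b] pays for the factor of order [n / eps] in the bound on separated
    sets. *)
Lemma entropy_le (A b b' : R) : 0 < A -> b' < b ->
  (forall n, (ncard (crits f n))%:R <= A * expR (n%:R * b')) ->
  (topological_entropy I f <= b%:E)%E.
Proof.
move=> A0 bb AP; apply: lime_le.
  apply: nonincreasing_at_right_is_cvge; near=> e => u v _ _ uv.
  apply: limn_esup_mono => n; apply: lee_wpmul2r.
    by rewrite inve_ge0 lee_fin ler0n.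
  by apply: lne_mono; [exact: separated_card_ge0|exact: separated_cardS].
near=> eps; have eps0 : 0 < eps by [].
pose d := b - b'; have d0 : 0 < d by rewrite subr_gt0.
(* Chosen so that [n / eps + 1 <= C * (1 + n * d)], which is at most [C * expR (n * d)]. *)
pose C := 1 + (eps * d)^-1; have ed0 : 0 < eps * d by rewrite mulr_gt0.
have C1 : 1 <= C by rewrite lerDl invr_ge0 ltW.
pose A' := A * C; have A'0 : 0 < A' by rewrite mulr_gt0//; lra.
have sP n : (separated_card I f n eps <= (A' * expR (n%:R * b))%:E)%E.
  apply: (le_trans (separated_card_le n eps0)); rewrite lee_fin natrM.
  have -> : A' * expR (n%:R * b) = (A * expR (n%:R * b')) * (C * expR (n%:R * d)).
    rewrite mulrACA -expRD -mulrDr /d.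
    by congr (_ * expR (_ * _)); ring.
  apply: ler_pM => //.
  have n0 : 0 <= n%:R / eps by rewrite divr_ge0// ltW.
  have /andP[tn _] := truncn_itv n0.
  rewrite -natr1; apply: (@le_trans _ _ (n%:R / eps + 1)); first by rewrite lerD2r.
  apply: (@le_trans _ _ (C * (1 + n%:R * d))); last first.
    by rewrite ler_wpM2l ?expR_ge1Dx//; lra.
  have -> : C * (1 + n%:R * d) =
      n%:R / eps + 1 + ((eps * d)^-1 + n%:R * d).
    by rewrite /C; field; rewrite !gt_eqF.
  rewrite lerDl addr_ge0 ?invr_ge0; [by []|exact: ltW|by rewrite mulr_ge0// ltW].
apply/lee_addgt0Pr => e e0; apply: limn_esup_near_le.
near=> n.
have n0 : (0 : R) < n%:R by rewrite ltr0n; near: n; exact: nbhs_infty_gt.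
rewrite inver gt_eqF// lee_pdivrMr// -EFinD -EFinM.
apply: (@le_trans _ _ (lne (A' * expR (n%:R * b))%:E)).
  by apply: lne_mono; [exact: separated_card_ge0|exact: sP].
have AE0 : 0 < A' * expR (n%:R * b) by exact: mulr_gt0 A'0 (expR_gt0 _).
rewrite lne_EFin// lee_fin lnM ?posrE ?expR_gt0// expRK.
rewrite mulrDl mulrC [b * _]mulrC addrC lerD2l.
have : ln A' / e <= n%:R by near: n; exact: nbhs_infty_ger.
by rewrite ler_pdivrMr// mulrC.
Unshelve. all: by end_near. Qed.

(** By [card_critsD], passing from [n - m] to [n] multiplies the bound by at most [expR (m * b)].
    The constant [A] takes care of the starting values [n < m]. *)
Lemma crits_growth m (b : R) : (0 < m)%N ->
  (2 * ncard (crits f m))%:R <= expR (m%:R * b) ->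
  exists2 A, 0 < A & forall n, (ncard (crits f n))%:R <= A * expR (n%:R * b).
Proof.
move=> m0 H.
pose A := 1 + \sum_(r < m) (ncard (crits f r))%:R / expR (r%:R * b).
have A1 : 1 <= A by rewrite lerDl sumr_ge0// => r _; rewrite divr_ge0 ?expR_ge0.
exists A => [|n]; first by lra.
elim/ltn_ind: n => n IH; have [nm|mn] := ltnP n m.
  rewrite -ler_pdivrMr ?expR_gt0// /A (bigD1 (Ordinal nm))//= addrCA lerDl.
  by rewrite addr_ge0// sumr_ge0// => r _; rewrite divr_ge0 ?expR_ge0.
have -> : n = (m + (n - m))%N by lia.
apply: (@le_trans _ _ ((2 * ncard (crits f m))%:R * (ncard (crits f (n - m)))%:R)).
  rewrite -natrM ler_nat -mulnA; exact: card_critsD.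
have -> : expR ((m + (n - m))%:R * b) = expR (m%:R * b) * expR ((n - m)%:R * b).
  by rewrite natrD mulrDl expRD.
by rewrite mulrCA ler_pM//; apply: IH; lia.
Qed.

End growth.


(** Divides the recurrence for [ncard (crits f n.+1)] by [lam ^+ n.+1]; here [l], [L], [M], [P]
    stand for [lam] and its powers of exponents [n], [n.+1 - K], [K]. *)
Lemma rescale_recurrence (R : realType) (q k l L M P d0 d1 d2 : R) :
  0 < q -> 0 < l -> 0 < L -> 0 < M -> 0 < P -> L * l = M * P ->
  d1 <= d0 + q * (k / (16 * q) * (L * l) + d2) ->
  d1 / (L * l) <= l^-1 * (d0 / L) + k / 16 + q * P^-1 * (d2 / M).
Proof.
move=> q0 l0 L0 M0 P0 LM H; rewrite ler_pdivrMr ?mulr_gt0//.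
apply: (le_trans H); rewrite le_eqVlt; apply/orP; left; apply/eqP.
have -> : q * (k / (16 * q) * (L * l) + d2) = k / 16 * (L * l) + q * d2.
  by field; rewrite gt_eqF.
rewrite [RHS]mulrDl [in X in _ = _ + X]LM [in RHS]mulrDl -addrA.
have -> : q * P^-1 * (d2 / M) * (M * P) = q * d2.
  by field; rewrite !gt_eqF.
by congr (_ + _); field; rewrite !gt_eqF.
Qed.

(** * Points with few preimages *)

Section small_preimages.
Context (R : realType) (f : R -> R).
Context (fc : continuous f).
Context (fI : forall t, unit_interval R t -> unit_interval R (f t)).
Context (ft : topologically_transitive (unit_interval R) f).
Context (fpm : piecewise_monotone f).
Context (lam : R).
Context (lam1 : 1 < lam).

Local Notation I := (unit_interval R).

(** This is [#f^-n(y) = o(lam^n)]. Points outside [I] are allowed: they are trivially small and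
    serve as outer neighbours of 0 and 1. *)
Definition small (y : R) : Prop := forall e, 0 < e ->
  \forall n \near \oo, (ncard (preims f n y))%:R <= e * lam ^+ n.

Let lam0 : 0 < lam. Proof. exact: lt_trans lam1. Qed.

(** Preimages of [y] of order [n] are preimages of [f^m y] of order [m + n]; the shift only costs
    the constant [lam ^+ m]. *)
Lemma small_iter m y : small (iter m f y) -> small y.
Proof.
move=> sx e e0; have em : 0 < e / lam ^+ m by rewrite divr_gt0// exprn_gt0.
have [n0 _ n0P] := sx _ em; exists n0 => // n /= n0n.
apply: (@le_trans _ _ (ncard (preims f (m + n) (iter m f y)))%:R).
  rewrite ler_nat; apply: ncard_sub; first exact: finite_preims.
  by move=> t [It /= tE]; split => //=; rewrite iterD tE.
have := n0P (m + n)%N; rewrite /= => /(_ (leq_trans n0n (leq_addl _ _))).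
by rewrite exprD mulrA divfK// gt_eqF// exprn_gt0.
Qed.

Lemma small_notin y : ~ I y -> small y.
Proof.
move=> nIy e e0; near=> n.
have -> : preims f n y = set0.
  apply/seteqP; split => // t [It /= tE]; apply: nIy; rewrite -tE.
  exact: iter_unit.
by rewrite /ncard fset_set0 cardfs0 mulr_ge0 ?exprn_ge0 ?ltW.
Unshelve. all: by end_near. Qed.

Lemma near_le_expr e : 0 < e -> \forall n \near \oo, 1 <= e * lam ^+ n.
Proof.
move=> e0; have l01 : 0 <= lam^-1 < 1 by rewrite invr_ge0 ltW//= invf_lt1.
have [k kP] := exp_small l01 e0; exists k => // n /= kn.
have : lam ^+ k <= lam ^+ n by rewrite ler_eXn2l.
have lk : 0 < lam ^+ k by rewrite exprn_gt0.
move: kP; rewrite exprVn -[_^-1]mul1r ltr_pdivrMr// => kP kn'.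
by apply: (le_trans (ltW kP)); rewrite ler_wpM2l// ltW.
Qed.

(** The images of [Crit f] up to time [K] form a finite set, so those other than [c] keep a distance
    from [c]. Within it, density of the backward orbit of [x] supplies small points on both
    sides. *)
Lemma Crit_small_neighbours (x c : R) (K : nat) : I x -> small x -> Crit f c ->
  exists y1 y2, [/\ small y1, small y2, y1 < c < y2 &
    forall i, (i <= K)%N -> forall c', Crit f c' ->
      y1 < iter i f c' < y2 -> iter i f c' = c].
Proof.
move=> Ix sx Cc.
pose O : set R := \bigcup_(i in `I_K.+1) (iter i f @` Crit f).
have fO : finite_set O.
  by apply: bigcup_finite => [|i _]; [exact: finite_II|exact: finite_image].
have [e e0 eP] := finite_isolated c fO.
have dense a b : 0 <= a -> a < b -> b <= 1 -> exists2 y, a < y < b & small y.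
  move=> a0 ab b1.
  have [y yab [m mE]] := backward_orbit_dense fc fI ft fpm Ix a0 ab b1.
  by exists y => //; apply: (@small_iter m); rewrite mE.
have [c0 c1] : 0 <= c /\ c <= 1 by apply/andP; rewrite -unit_intervalE; exact: Crit_unit Cc.
have [y1 y1c sy1] : exists2 y1, c - e <= y1 < c & small y1.
  have [c00|c00] := leP c 0.
    by exists (c - e); [lra|apply: small_notin; rewrite unit_intervalE; lra].
  have mc : Num.max 0 (c - e) < c by rewrite gt_max; lra.
  have [||y] := dense _ _ _ mc; rewrite ?le_max ?lexx//.
  by rewrite gt_max => yc sy; exists y => //; lra.
have [y2 y2c sy2] : exists2 y2, c < y2 <= c + e & small y2.
  have [c11|c11] := leP 1 c.
    by exists (c + e); [lra|apply: small_notin; rewrite unit_intervalE; lra].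
  have mc : c < Num.min 1 (c + e) by rewrite lt_min; lra.
  have [||y] := dense _ _ _ mc; rewrite ?ge_min ?lexx//.
  by rewrite lt_min => yc sy; exists y => //; lra.
exists y1, y2; split => //; first lra.
move=> i iK c' Cc' ic; apply/eqP; apply: contraT => ne.
have Oi : O (iter i f c') by exists i => //; exists c'.
by have := eP _ Oi ne; rewrite ltr_normr => /orP[]; lra.
Qed.

Lemma preims_Crit_le (x : R) (K : nat) (d : R) : I x -> small x -> 0 < d ->
  \forall n \near \oo, forall c, Crit f c ->
    (ncard (preims f n c))%:R <= d * lam ^+ n + (ncard (crits f (n - K)))%:R.
Proof.
move=> Ix sx d0; apply: finite_eventually => // c Cc.
have [y1 [y2 [s1 s2 y12 yK]]] := Crit_small_neighbours K Ix sx Cc.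
(* One third each for the constant 1 and the preimages of [y1] and [y2]. *)
have d30 : 0 < d / 3 by rewrite divr_gt0.
near=> n.
apply: (@le_trans _ _ (1 + (ncard (preims f n y1))%:R + (ncard (preims f n y2))%:R
   + (ncard (crits f (n - K)))%:R)).
  rewrite -[1]/(1%:R) -!natrD ler_nat.
  exact: (card_preims_le fc fI ft fpm _ y12).
rewrite lerD2r.
have h0 : 1 <= d / 3 * lam ^+ n by near: n; exact: near_le_expr.
have h1 : (ncard (preims f n y1))%:R <= d / 3 * lam ^+ n by near: n; exact: s1.
have h2 : (ncard (preims f n y2))%:R <= d / 3 * lam ^+ n by near: n; exact: s2.
lra.
Unshelve. all: by end_near. Qed.

Lemma ncard_critsS n M : (forall c, Crit f c -> ncard (preims f n.+1 c) <= M)%N ->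
  (ncard (crits f n.+1) <= ncard (crits f n) + ncard (Crit f) * M)%N.
Proof.
move=> MP; have fU : finite_set (\bigcup_(c in Crit f) preims f n.+1 c).
  by apply: bigcup_finite => // c _; exact: finite_preims.
apply: (leq_trans (ncard_sub _ _)); last first.
- apply: (leq_trans (ncard_setU (finite_crits fc fI ft fpm n) fU)).
  by rewrite leq_add2l; apply: ncard_bigcup => // c _; exact: finite_preims.
- move=> t [It [j]]; rewrite leq_eqVlt => /orP[/eqP -> Cj|jn Cj].
    by right; exists (iter n.+1 f t).
  by left; split => //; exists j.
- by rewrite finite_setU; split => //; exact: finite_crits.
Qed.

(** Otherwise the normalised count [u] stays above 1/4, while the recurrence drives it to 0. The
    constant 4, where [crits_growth] only asks for 2, leaves room to lower the exponent. *)
Lemma crits_small (x : R) : I x -> small x ->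
  exists m, 4 * (ncard (crits f m))%:R <= lam ^+ m.
Proof.
move=> Ix sx; apply: contrapT => nm.
have dP m : lam ^+ m < 4 * (ncard (crits f m))%:R.
  by rewrite ltNge; apply/negP => H; apply: nm; exists m.
pose u m : R := (ncard (crits f m))%:R / lam ^+ m.
have lamn n : 0 < lam ^+ n by rewrite exprn_gt0.
have u4 m : 4^-1 < u m.
  by rewrite ltr_pdivlMr// mulrC ltr_pdivrMr// mulrC.
pose q : R := (ncard (Crit f))%:R.
have q0 : 0 < q by rewrite ltr0n; apply: ncard_gt0 => //; exists 0; left; left.
pose k : R := 1 - lam^-1.
have l01 : 0 <= lam^-1 < 1 by rewrite invr_ge0 ltW//= invf_lt1.
have k0 : 0 < k by rewrite /k; lra.
have kq4 : 0 < k / (4 * q) by rewrite divr_gt0// mulr_gt0.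
have u0 n : 0 <= u n by rewrite divr_ge0// ltW.
(* The successor makes [K] positive, as [window_decay] requires. *)
have [K0 K0P] := exp_small l01 kq4; pose K := K0.+1.
have KP : q * lam^-1 ^+ K <= k / 4.
  have : lam^-1 ^+ K <= lam^-1 ^+ K0 by rewrite exprSr ler_piMr ?exprn_ge0//; lra.
  move=> /le_lt_trans/(_ K0P); rewrite ltr_pdivlMr ?mulr_gt0//; lra.
have kq : 0 < k / (16 * q) by rewrite divr_gt0// mulr_gt0.
have [n0 _ n0P] := preims_Crit_le K Ix sx kq.
have step n : (n0 + K <= n)%N ->
    u n.+1 <= (1 - k / 2) * Num.max (u n) (u (n.+1 - K)%N).
  move=> n0n.
  have nK : (n.+1 - K + K = n.+1)%N.
    by rewrite subnK// (leq_trans (leq_addl n0 K))// leqW.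
  have n0n1 : (n0 <= n.+1)%N by rewrite (leq_trans (leq_addr K n0))// leqW.
  pose X : R := k / (16 * q) * lam ^+ n.+1 + (ncard (crits f (n.+1 - K)))%:R.
  have X0 : 0 <= X by rewrite addr_ge0// mulr_ge0// ltW.
  (* [ncard_critsS] takes a natural bound, so the real bound [X] is replaced by its integer part. *)
  have /andP[tX Xt] := truncn_itv X0.
  have dn : (ncard (crits f n.+1))%:R <= (ncard (crits f n))%:R + q * X.
    apply: (@le_trans _ _ (ncard (crits f n) +
        ncard (Crit f) * Num.truncn X)%N%:R).
      rewrite ler_nat; apply: ncard_critsS => c Cc.
      rewrite -ltnS -(ltr_nat R); apply: le_lt_trans Xt.
      exact: (n0P n.+1).
    by rewrite natrD natrM lerD2l ler_wpM2l// ltW.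
  have un : u n.+1 <= lam^-1 * u n + k / 16 + q * lam^-1 ^+ K * u (n.+1 - K)%N.
    have lK : lam ^+ n * lam = lam ^+ (n.+1 - K) * lam ^+ K.
      by rewrite -exprSr -exprD nK.
    rewrite /u /X exprSr exprVn in dn *.
    exact: rescale_recurrence dn.
  have := u4 n; set m := Num.max _ _.
  have um : u n <= m by rewrite le_max lexx.
  have um' : u (n.+1 - K)%N <= m by rewrite le_max lexx orbT.
  have li0 : 0 <= lam^-1 by case/andP: l01.
  have hK : q * lam^-1 ^+ K * u (n.+1 - K)%N <= k / 4 * m.
    by apply: ler_pM KP um' => //; exact: mulr_ge0 (ltW q0) (exprn_ge0 _ li0).
  have hn : (lam^-1 + k / 4) * u n <= (lam^-1 + k / 4) * m.
    by rewrite ler_wpM2l//; lra.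
  move=> u4n; apply: (le_trans un).
  (* The lower bound 1/4 on [u n] turns the additive error into a multiplicative one. The
     coefficients then sum to [lam^-1 + k / 4 + k / 4 = 1 - k / 2]. *)
  have : k / 16 <= k / 4 * u n.
    have -> : k / 16 = k / 4 * 4^-1 by field.
    by rewrite ler_wpM2l// ltW// divr_gt0.
  rewrite /k in hK hn *; nra.
have t01 : 0 <= 1 - k / 2 < 1 by rewrite /k; lra.
have Kn0 : (0 < K <= n0 + K)%N by rewrite leq_addl.
have [|n un] := window_decay t01 Kn0 u0 step (_ : 0 < 4^-1); first by rewrite invr_gt0.
by have := u4 n; rewrite ltNge ltW.
Qed.

End small_preimages.


(** * The theorem for maps continuous on the whole line *)

Lemma expeR_inv_ge1 (R : realType) (y : \bar R) : (y <= 0)%E -> (1 <= (expeR y)^-1)%E.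
Proof.
move=> y0; have e0 := expeR_ge0 y.
have : (expeR y <= 1)%E.
  by case: y y0 {e0} => [r| |] //=; rewrite !lee_fin -expR0 ler_expR.
case: (expeR y) e0 => [r| |] //; rewrite !lee_fin => r0 r1.
rewrite inver; case: eqP => [_|/eqP rn]; first by rewrite leey.
by rewrite lee_fin invf_ge1// lt_def rn.
Qed.

Lemma limn_esup_preimages_continuous (R : realType) (f : R -> R) :
  continuous f -> (forall t, unit_interval R t -> unit_interval R (f t)) ->
  topologically_transitive (unit_interval R) f -> piecewise_monotone f ->
  forall x, unit_interval R x ->
  (0 < limn_esup (fun n : nat =>
     counting (unit_interval R `&` iter n f @^-1` [set x])
       / expeR (n%:R%:E * topological_entropy (unit_interval R) f)))%E.
Proof.
move=> fc fI ft fpm x Ix; set h := topological_entropy _ _.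
have cnt n : counting (unit_interval R `&` iter n f @^-1` [set x]) =
    (ncard (preims f n x))%:R%:E :> \bar R.
  by rewrite /counting asboolT//; exact: finite_preims.
(* For [h <= 0] every quotient is at least 1: surjectivity gives a preimage, and the exponential is
   at most 1. *)
have [h0|h0] := leP h 0%E.
  apply: lt_le_trans (limn_esup_ge (l := 1%E) _); first exact: lte01.
  move=> n; rewrite cnt -[1%E]mul1e; apply: lee_pmul => //.
    rewrite lee_fin ler1n; apply: ncard_gt0; first exact: finite_preims.
    by have [t It tx] := iter_surj fc fI ft n Ix; exists t.
  by apply: expeR_inv_ge1; apply: mule_ge0_le0 => //; rewrite lee_fin.
have hfin : (h < +oo)%E.
  have d0 : (0 : R) < (2 * ncard (crits f 1))%:R.
    by rewrite ltr0n muln_gt0//; exact: card_crits_gt0.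
  pose b := ln (2 * ncard (crits f 1))%:R : R.
  have [|A A0 AP] := crits_growth fc fI ft fpm (b := b) (ltnSn 0).
    by rewrite mul1r lnK.
  apply: (@le_lt_trans _ _ (b + 1)%:E); last exact: ltry.
  by apply: entropy_le AP => //; rewrite ltrDl.
have [r hr] : exists r, h = r%:E.
  by case: (h) h0 hfin => [r| |] // _ _; exists r.
have r0 : 0 < r by move: h0; rewrite hr lte_fin.
rewrite ltNge; apply/negP => sup0.
have sx : small f (expR r) x.
  move=> e e0; have : (limn_esup (fun n : nat =>
     counting (unit_interval R `&` iter n f @^-1` [set x])
       / expeR (n%:R%:E * h)) < e%:E)%E by apply: le_lt_trans sup0 _; rewrite lte_fin.
  move=> /limn_esup_lt; apply: filterS => n.
  rewrite cnt hr -EFinM /= inver gt_eqF ?expR_gt0// -EFinM lte_fin.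
  by rewrite ltr_pdivrMr ?expR_gt0// expRM_natl => /ltW.
have l1 : 1 < expR r by rewrite expR_gt1.
have [m mP] := crits_small fc fI ft fpm l1 Ix sx.
have m0 : (0 < m)%N.
  case: m mP => //; rewrite expr0.
  have : (1 : R) <= (ncard (crits f 0))%:R by rewrite ler1n; exact: card_crits_gt0.
  by move=> d1 d4; exfalso; move: d1 d4; clear; lra.
(* Then [expR (m * b)] is half of [expR r ^+ m], which still bounds [2 * ncard (crits f m)]. *)
pose b := r - ln 2 / m%:R.
have mR : (0 : R) < m%:R by rewrite ltr0n.
have br : b < r by rewrite ltrBlDr ltrDl divr_gt0// ln_gt0// ltr1n.
have [|A A0 AP] := crits_growth fc fI ft fpm (b := b) m0.
  have -> : m%:R * b = m%:R * r - ln 2 by rewrite /b; field; rewrite gt_eqF.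
  by rewrite expRD expRN lnK ?posrE// expRM_natl ler_pdivlMr// natrM; move: mP; clear; lra.
(* The midpoint lies strictly above [b], as [entropy_le] demands, and strictly below [r = h]. *)
have : (h <= ((b + r) / 2)%:E)%E.
  by apply: entropy_le AP => //; move: br; clear; lra.
by rewrite hr lee_fin; move: br; clear; lra.
Qed.

(** * Reduction to a map continuous on the whole line *)

Definition clamp (R : realType) (t : R) : R := Num.max 0 (Num.min 1 t).

Lemma clamp_unit (R : realType) (t : R) : unit_interval R (clamp t).
Proof. by rewrite unit_intervalE /clamp le_max lexx/= ge_max ler01 ge_min lexx. Qed.

Lemma clamp_id (R : realType) (t : R) : unit_interval R t -> clamp t = t.
Proof. by rewrite unit_intervalE => /andP[t0 t1]; rewrite /clamp min_r// max_r. Qed.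

Lemma clamp_lipschitz (R : realType) (s t : R) : `|clamp s - clamp t| <= `|s - t|.
Proof.
rewrite /clamp; case: (leP 1 s) => s1; case: (leP 1 t) => t1;
  rewrite ?[Num.max 0 1]max_r//; try (case: (leP 0 s) => s0); try (case: (leP 0 t) => t0);
  rewrite ler_norml; have := ler_norm (s - t); have := ler_norm (t - s);
  rewrite distrC; try lra.
Qed.

Lemma continuous_clamp (R : realType) (f : R -> R) :
  {within unit_interval R, continuous f} -> continuous (f \o @clamp R).
Proof.
move=> /subspace_continuousP fc t; apply/cvgrPdist_lt => e e0 /=.
have /cvgrPdist_lt/(_ e e0) := fc (clamp t) (clamp_unit t).
rewrite near_withinE => /nbhs_ballP[d /= d0 dP].
apply/nbhs_ballP; exists d => // s /= st; apply: dP; last exact: clamp_unit.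
by rewrite /ball/=; apply: le_lt_trans st; exact: clamp_lipschitz.
Qed.

Theorem theorem1 (R : realType) (f : R -> R)
    (f_maps : f @` unit_interval R `<=` unit_interval R)
    (f_cont : {within unit_interval R, continuous f})
    (f_trans : topologically_transitive (unit_interval R) f)
    (f_pm : piecewise_monotone f)
    (x : R) (x01 : unit_interval R x) :
  (0 < limn_esup (fun n : nat =>
     counting (unit_interval R `&` iter n f @^-1` [set x])
       / expeR (n%:R%:E * topological_entropy (unit_interval R) f)))%E.
Proof.
(* [g] is continuous on the line and agrees with [f] on [I], as do all iterates. Transitivity,
   entropy and preimage counts depend only on these restrictions, and [Crit g] is contained in
   [Crit f]. *)
pose g : R -> R := f \o @clamp R.
have gf t : unit_interval R t -> g t = f t by move=> It; rewrite /g /= clamp_id.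
have gI t : unit_interval R t -> unit_interval R (g t).
  by move=> It; rewrite gf//; apply: f_maps; exists t.
have gfn n t : unit_interval R t -> iter n g t = iter n f t.
  by move=> It; elim: n => //= n <-; apply: gf; exact: iter_unit.
have gt : topologically_transitive (unit_interval R) g.
  move=> U V Uo Vo UI VI; have [n n1 [_ [[t [Ut It] <-] Vt]]] := f_trans U V Uo Vo UI VI.
  by exists n => //; exists (iter n f t); split => //; exists t; rewrite ?gfn.
have gpm : piecewise_monotone g.
  apply: sub_finite_set f_pm => t [t01|[It nm]]; first by left.
  right; split => // -[U Ut mU]; apply: nm; exists U => //.
  by case: mU => mU; [left|right] => s s' [Us Is] [Us' Is'] ss'; rewrite !gf//; exact: mU.
have := limn_esup_preimages_continuous (continuous_clamp f_cont) gI gt gpm x01.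
have -> : topological_entropy (unit_interval R) (f \o @clamp R) =
    topological_entropy (unit_interval R) f.
  rewrite /topological_entropy /separated_card.
  have -> // : Defs.separated (unit_interval R) (f \o @clamp R) =
      Defs.separated (unit_interval R) f.
  apply/funext => n; apply/funext => eps; apply/funext => E; apply/propext.
  by split=> -[EI Es]; split=> // s s' Es1 Es2 /(Es _ _ Es1 Es2)[k kn H]; exists k => //;
    move: H; rewrite !gfn//; exact: EI.
have -> : (fun n : nat =>
    counting (unit_interval R `&` iter n (f \o @clamp R) @^-1` [set x])
      / expeR (n%:R%:E * topological_entropy (unit_interval R) f))%E =
  (fun n : nat => counting (unit_interval R `&` iter n f @^-1` [set x])
      / expeR (n%:R%:E * topological_entropy (unit_interval R) f))%E.
  apply/funext => n; congr (counting _ / _)%E.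
  by apply/seteqP; split => t [It /= tx]; split => //=; rewrite -tx gfn.
by [].
Qed.
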